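(* The following decision problem is poset-isomorphism complete: given two finite posets $\mathcal P$ and $\mathcal Q$, decide whether $\mathcal P$ is rotation-equivalent to some poset isomorphic to $\mathcal Q$. That is, this problem and the problem of deciding whether two given finite posets are isomorphic are polynomial-time reducible to each other.
   Context: For a poset $(P,\leq)$: $x<y$ means $x\le y$, $x\ne y$; $x\perp y$ means $x,y$ incomparable; $X<Y$ for sets means $x<y$ for all $x\in X,y\in Y$. A downset is $X$ with $y<x\in X\Rightarrow y\in X$; an up-set dually. If $A,C\subseteq P$ are disjoint, $A$ is a downset, $C$ is an up-set and $A<C$, and $B:=P\setminus(A\cup C)$, then the rotation $\mathfrak R_{A,C}(P,\leq)$ is $(P,\preceq)$ with $x\preceq y$ iff: (i) $x,y$ both in $A$, both in $B$ or both in $C$, and $x\le y$; or (ii) $x\in B$, $y\in A$, $x\perp y$; or (iii) $x\in C$, $y\in A$; or (iv) $x\in C$, $y\in B$, $x\perp y$. Two posets on the same set are rotation-equivalent if one can be transformed into the other by a finite sequence of rotations (each rotation applied to the current poset). *)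

(* Defs.v *)
From mathcomp Require Import all_boot.
From Stdlib Require Import Relation_Operators.

Set Implicit Arguments.
Unset Strict Implicit.
Unset Printing Implicit Defensive.

Section Rotation.

Variable T : finType.
Implicit Types (r : rel T) (A C X : {set T}).

Definition slt r : rel T := fun x y => r x y && (x != y).

Definition incomparable r : rel T := fun x y => ~~ r x y && ~~ r y x.

Definition downset r X := forall x y, x \in X -> slt r y x -> y \in X.

Definition upset r X := forall x y, x \in X -> slt r x y -> y \in X.

Definition set_lt r A C := forall x y, x \in A -> y \in C -> slt r x y.

Definition rotatable r A C :=
  [/\ [disjoint A & C], downset r A, upset r C & set_lt r A C].

Definition rotation r A C : rel T := fun x y =>
  let B := ~: (A :|: C) in
  [|| [|| (x \in A) && (y \in A), (x \in B) && (y \in B)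
        | (x \in C) && (y \in C)] && r x y,
      [&& x \in B, y \in A & incomparable r x y],
      (x \in C) && (y \in A)
    | [&& x \in C, y \in B & incomparable r x y]].

Definition rotates_to r r' :=
  exists A C, rotatable r A C /\ r' =2 rotation r A C.

Definition rotation_equivalent : rel T -> rel T -> Prop :=
  clos_refl_trans (rel T) rotates_to.

End Rotation.

Definition isomorphic (T U : finType) (r : rel T) (s : rel U) :=
  exists f : T -> U, bijective f /\ forall x y, r x y = s (f x) (f y).

(* Finite posets as inputs of algorithms: the ground set is {0, ..., n-1}. *)
Record finposet := FinPoset {
  card : nat;
  le : rel 'I_card;
  le_refl : reflexive le;
  le_anti : antisymmetric le;
  le_trans : transitive le
}.

(* Bit-string encoding: n in unary, a 0 as end mark, then the n^2 entries of
   the order matrix, row by row. It is self-delimiting, so that a pair can be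
   encoded by concatenation. *)
Definition encode_poset (P : finposet) : seq bool :=
  nseq (card P) true ++
  false :: [seq le x y | x <- enum 'I_(card P), y <- enum 'I_(card P)].

Definition encode_pair (PQ : finposet * finposet) : seq bool :=
  encode_poset PQ.1 ++ encode_poset PQ.2.

(* The model of computation is the random access machine of Cook and Reckhow
   (cells X_0, X_1, ... holding naturals, addition and truncated subtraction
   but no multiplication, indirect addressing, unit cost), with if and while
   instead of jumps. It is polynomially equivalent to Turing machines: after t
   steps at most t cells are nonzero and the numbers in them have O(t) bits.
   The input is a read-only bit string; the output is written bit by bit, so
   that its length is at most the running time. *)
Inductive cmd : Type :=
  | Const of nat & nat         (* Const x c     X_x := c              *)
  | Add of nat & nat & nat     (* Add x y z     X_x := X_y + X_z      *)
  | Sub of nat & nat & nat     (* Sub x y z     X_x := X_y - X_z      *)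
  | Fetch of nat & nat         (* Fetch x y     X_x := X_(X_y)        *)
  | Store of nat & nat         (* Store x y     X_(X_x) := X_y        *)
  | Read of nat & nat          (* Read x y      X_x := read w X_y     *)
  | Write of bool
  | Seq of cmd & cmd
  | If of nat & cmd & cmd      (* If x c1 c2    if X_x > 0            *)
  | While of nat & cmd.        (* While x c     while X_x > 0         *)

Record state := State { mem : nat -> nat; out : seq bool }.

Definition init : state := State (fun _ => 0) [::].

Definition set_cell (s : state) (x v : nat) : state :=
  State (fun k => if k == x then v else mem s k) (out s).

(* The bits of w read as 1 and 2, so that 0 marks the end of the input. *)
Definition read (w : seq bool) (i : nat) : nat :=
  nth 0 [seq (nat_of_bool b).+1 | b <- w] i.

(* exec w c s t s': on input w, the program c started in state s halts in
   state s' after t steps. *)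
Inductive exec (w : seq bool) : cmd -> state -> nat -> state -> Prop :=
  | ExecConst x c s : exec w (Const x c) s 1 (set_cell s x c)
  | ExecAdd x y z s :
      exec w (Add x y z) s 1 (set_cell s x (mem s y + mem s z))
  | ExecSub x y z s :
      exec w (Sub x y z) s 1 (set_cell s x (mem s y - mem s z))
  | ExecFetch x y s : exec w (Fetch x y) s 1 (set_cell s x (mem s (mem s y)))
  | ExecStore x y s : exec w (Store x y) s 1 (set_cell s (mem s x) (mem s y))
  | ExecRead x y s : exec w (Read x y) s 1 (set_cell s x (read w (mem s y)))
  | ExecWrite b s : exec w (Write b) s 1 (State (mem s) (rcons (out s) b))
  | ExecSeq c1 c2 s t1 s1 t2 s2 :
      exec w c1 s t1 s1 -> exec w c2 s1 t2 s2 ->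
      exec w (Seq c1 c2) s (t1 + t2) s2
  | ExecIfT x c1 c2 s t s' :
      0 < mem s x -> exec w c1 s t s' -> exec w (If x c1 c2) s t.+1 s'
  | ExecIfF x c1 c2 s t s' :
      mem s x = 0 -> exec w c2 s t s' -> exec w (If x c1 c2) s t.+1 s'
  | ExecWhileT x c s t1 s1 t2 s2 :
      0 < mem s x -> exec w c s t1 s1 -> exec w (While x c) s1 t2 s2 ->
      exec w (While x c) s (t1 + t2).+1 s2
  | ExecWhileF x c s : mem s x = 0 -> exec w (While x c) s 1 s.

Definition polytime_computable (I J : Type) (encI : I -> seq bool)
    (encJ : J -> seq bool) (f : I -> J) :=
  exists (c : cmd) (a d : nat), forall x : I, exists (t : nat) (s : state),
    [/\ exec (encI x) c init t s,
        out s = encJ (f x)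
      & t <= a * size (encI x) ^ d + a].

Record decision_problem := DecisionProblem {
  instance : Type;
  encode : instance -> seq bool;
  yes : instance -> Prop
}.

Definition polytime_reducible (A B : decision_problem) :=
  exists f : instance A -> instance B,
    polytime_computable (@encode A) (@encode B) f /\
    forall x, yes x <-> yes (f x).

Definition poset_isomorphism : decision_problem :=
  @DecisionProblem (finposet * finposet) encode_pair
    (fun PQ => isomorphic (@le PQ.1) (@le PQ.2)).

Definition rotation_equivalence_up_to_isomorphism : decision_problem :=
  @DecisionProblem (finposet * finposet) encode_pair
    (fun PQ => exists r : rel 'I_(card PQ.1),
       [/\ reflexive r, antisymmetric r & transitive r] /\
       rotation_equivalent (@le PQ.1) r /\ isomorphic r (@le PQ.2)).

(* Main.v *)
From Stdlib Require Import Relation_Operators.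
From mathcomp Require Import all_boot all_order all_algebra zify.
Require Import Defs.

Set Implicit Arguments.
Unset Strict Implicit.
Unset Printing Implicit Defensive.

Import GRing.Theory Num.Theory.

(* Record a poset by its gaps, gap x y = -1, 0, 1 according as x < y, x and y are
   incomparable, x > y. A rotation adds to the gaps the coboundary of a function
   with values -1 on A, 0 on B, 1 on C, and conversely two posets whose gaps
   differ by a coboundary are related by one rotation. So the rotation class is
   determined by the cyclic sums cyc x y z = gap x y + gap y z + gap z x, which
   again lie in {-1, 0, 1}.

   Rotation-equivalence reduces to isomorphism: for every x the relation
   cyc x y z = -1 is the strict order, off x, of the rotation with least element
   x. The disjoint union of these n rotations depends only on the class, and since
   its components are the single rotations, it determines the class.

   Isomorphism reduces to rotation-equivalence: add to P a least element and a
   large antichain of isolated points. By pigeonhole some isolated point is mapped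
   to an isolated point, and the cyclic sums through that point are the gaps. *)

(** * Rotations and gaps *)

Section Gap.
Local Open Scope ring_scope.
Variables (T : finType) (r : rel T).

Definition gap (x y : T) : int := (r y x)%:Z - (r x y)%:Z.

Definition cyc (x y z : T) : int := gap x y + gap y z + gap z x.

Lemma gapxx x : gap x x = 0.
Proof. by rewrite /gap subrr. Qed.

Lemma gapC x y : gap y x = - gap x y.
Proof. by rewrite /gap opprB. Qed.

Lemma gap_bound x y : -1 <= gap x y <= 1.
Proof. by rewrite /gap; case: (r x y) (r y x) => [] []. Qed.

Lemma cycC x y z : cyc x z y = - cyc x y z.
Proof. rewrite /cyc (gapC y z) (gapC x y) (gapC z x); lia. Qed.

(** The gaps between [x] and the other points cancel in pairs. Hence the cyclic sums through one
    fixed point determine all of them. *)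
Lemma cyc_cocycle x a b c : cyc a b c = cyc x a b + cyc x b c + cyc x c a.
Proof. rewrite /cyc (gapC x a) (gapC x b) (gapC x c); lia. Qed.

Hypotheses (rR : reflexive r) (rA : antisymmetric r).

Lemma le_gap x y : r x y = (x == y) || (gap x y == -1).
Proof.
rewrite /gap; have [->|nxy] := eqVneq x y; first exact: rR.
have := @rA x y; case: (r x y) (r y x) => [] [] //= /(_ isT) exy.
by rewrite exy eqxx in nxy.
Qed.

(** If two of the three gaps are -1, transitivity makes the third equal to 1, and dually; so the sum
    cannot reach -2 or 2. *)
Lemma cyc_bound x y z : transitive r -> -1 <= cyc x y z <= 1.
Proof.
move=> tr.
move: (tr y x z) (tr x z y) (tr z y x) (tr z x y) (tr y z x) (tr x y z).
rewrite /cyc /gap; clear.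
case: (r x y) (r y x) (r y z) (r z y) (r x z) (r z x) => [] [] [] [] [] [] //;
  do ?[move/(_ isT isT) => // | move=> _ //].
Qed.

End Gap.

(** Gaps within a block stay. The downset and up-set conditions leave only the gaps -1 and 0 from
    [A] to [B] and from [B] to [C], which become 0 and 1; from [A] to [C] the gap -1 becomes 1. *)
Lemma gap_rotation (T : finType) (r : rel T) (A C : {set T}) :
  rotatable r A C ->
  let h x : int := ((x \in C)%:Z - (x \in A)%:Z)%R in
  forall x y, gap (rotation r A C) x y = (gap r x y + h y - h x)%R.
Proof.
case=> dAC dA uC ltAC /= x y; rewrite /gap /rotation /incomparable !inE.
have dis u : (u \in A) && (u \in C) = false.
  by apply/negP => /andP[uA uC']; rewrite (disjointFr dAC uA) in uC'.
have down u v : u \in A -> v \notin A -> r v u = false.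
  move=> uA vA; apply/negP => rvu; case/negP: (vA); apply: (dA u v uA).
  by rewrite /slt rvu; apply: contraNneq vA => ->.
have up u v : u \in C -> v \notin C -> r u v = false.
  move=> uA vA; apply/negP => ruv; case/negP: (vA); apply: (uC u v uA).
  by rewrite /slt ruv; apply: contraNneq vA => <-.
have lt u v : u \in A -> v \in C -> r u v.
  by move=> uA vC; case/andP: (ltAC u v uA vC).
move: (dis x) (dis y) (down x y) (down y x) (up x y) (up y x) (lt x y) (lt y x).
case: (x \in A) (x \in C) (y \in A) (y \in C) => [] [] [] [] //= _ _;
  do ?[move/(_ isT isT) -> | move=> _]; by case: (r x y) (r y x) => [] [].
Qed.

Lemma rotation_refl (T : finType) (r : rel T) (A C : {set T}) :
  reflexive r -> reflexive (rotation r A C).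
Proof.
move=> rR x; rewrite /rotation !inE rR.
by case: (x \in A) (x \in C) => [] [].
Qed.

Lemma rotation_anti (T : finType) (r : rel T) (A C : {set T}) :
  [disjoint A & C] -> antisymmetric r -> antisymmetric (rotation r A C).
Proof.
move=> dAC rA x y rot; apply: rA; move: rot.
have dis u : (u \in A) && (u \in C) = false.
  by apply/negP => /andP[uA uC]; rewrite (disjointFr dAC uA) in uC.
rewrite /rotation !inE; move: (dis x) (dis y).
case: (x \in A) (x \in C) (y \in A) (y \in C) => [] [] [] [] //= _ _;
  by rewrite ?orbF ?andbF.
Qed.

Lemma gap_rotation_equivalent (T : finType) (r r' : rel T) :
  rotation_equivalent r r' ->
  exists h : T -> int, forall x y, gap r' x y = (gap r x y + h y - h x)%R.
Proof.
elim=> {r r'} [r r' [A [C [rAC er']]]|r|r1 r2 r3 _ [h eh] _ [k ek]].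
- exists (fun x => (x \in C)%:Z - (x \in A)%:Z)%R => x y.
  by rewrite -gap_rotation // /gap !er'.
- by exists (fun=> 0%R) => x y; lia.
- by exists (fun x => h x + k x)%R => x y; rewrite ek eh; lia.
Qed.

(* Since gaps lie in [-1, 1], a potential [h] takes at most three consecutive
   values, the fibres of which are the sets A, B and C of a single rotation. *)
Lemma rotates_to_gap (T : finType) (r r' : rel T) (h : T -> int) :
  reflexive r -> antisymmetric r -> reflexive r' -> antisymmetric r' ->
  (forall x y, gap r' x y = gap r x y + h y - h x)%R -> rotates_to r r'.
Proof.
move=> rR rA rR' rA' eh.
have [m mP] : exists m : int, forall x, (m <= h x <= m + 2)%R.
  case: (pickP (@predT T)) => [x0 _|T0]; last by exists 0%R => x; have := T0 x.
  case: (Order.TotalTheory.arg_minP h (erefl : predT x0)) => a _ amin.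
  exists (h a) => x; have := eh a x; have := amin x isT.
  by have := gap_bound r a x; have := gap_bound r' a x; lia.
pose A := [set x | h x == m]; pose C := [set x | h x == m + 2]%R.
(* If [y] is below [x] in [r] and [h x = m], then [gap r' y x = -1 + m - h y], and its lower bound
   -1 forces [h y = m]; dually for [C]. From [A] to [C] the potential rises by 2, so the gap in [r]
   can only be -1. *)
have rot : rotatable r A C.
  split=> [|x y|x y|x y]; rewrite ?inE.
  - by apply/pred0P => x /=; rewrite !inE; lia.
  - move=> /eqP hx /andP[ryx nyx]; have := eh y x; rewrite (le_gap rR rA) (negPf nyx) in ryx.
    by have := gap_bound r' y x; have := mP y; lia.
  - move=> /eqP hx /andP[rxy nxy]; have := eh x y; rewrite (le_gap rR rA) (negPf nxy) in rxy.
    by have := gap_bound r' x y; have := mP y; lia.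
  - move=> /eqP hx /eqP hy; rewrite /slt (le_gap rR rA).
    have -> : x != y by apply/eqP => exy; move: hx hy; rewrite exy; lia.
    rewrite andbT; apply/orP; right; have := eh x y.
    by have := gap_bound r' x y; have := gap_bound r x y; lia.
exists A, C; split=> // x y.
have rotR : reflexive (rotation r A C) by exact: rotation_refl.
have rotA : antisymmetric (rotation r A C).
  by case: rot => dAC _ _ _; apply: rotation_anti.
rewrite (le_gap rR' rA') (le_gap rotR rotA) eh gap_rotation //.
congr (_ || (_ == _)); rewrite !inE; by have := mP x; have := mP y; lia.
Qed.

Definition rotation_isomorphic (T U : finType) (r : rel T) (s : rel U) :=
  exists r' : rel T,
    [/\ reflexive r', antisymmetric r' & transitive r'] /\
    rotation_equivalent r r' /\ isomorphic r' s.

Definition cyc_isomorphic (T U : finType) (r : rel T) (s : rel U) :=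
  exists f : T -> U, bijective f /\
    forall x y z, cyc s (f x) (f y) (f z) = cyc r x y z.

(** For the converse, [s] is pulled back along [f]: equal cyclic sums make the two gap functions
    differ by a coboundary, so a single rotation suffices. *)
Lemma rotation_isomorphicP (T U : finType) (r : rel T) (s : rel U) :
  reflexive r -> antisymmetric r ->
  reflexive s -> antisymmetric s -> transitive s ->
  rotation_isomorphic r s <-> cyc_isomorphic r s.
Proof.
move=> rR rA sR sA sT; split=> [[r' [_ [/gap_rotation_equivalent[h eh]]]]|].
  case=> f [bf ef]; exists f; split=> // x y z.
  have gapf a b : gap s (f a) (f b) = gap r' a b by rewrite /gap !ef.
  by rewrite /cyc !gapf !eh; lia.
case=> f [bf ef]; exists (fun x y => s (f x) (f y)); split.
  split=> [x|x y /sA /(bij_inj bf) //|y x z]; [exact: sR|exact: sT].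
split; last by exists f.
apply: rt_step.
have [h eh] : exists h : T -> int,
    forall x y, gap (fun x y => s (f x) (f y)) x y = (gap r x y + h y - h x)%R.
  case: (pickP (@predT T)) => [x0 _|T0]; last by exists (fun=> 0%R) => x; have := T0 x.
  (* The potential is the difference of the gaps to a base point [x0]; the required identity is the
     equality of the cyclic sums at [x0], [x], [y]. *)
  exists (fun x => gap r x x0 - gap s (f x) (f x0))%R => x y.
  rewrite -[LHS]/(gap s (f x) (f y)); have := ef x0 x y.
  by rewrite /cyc (gapC r x x0) (gapC s (f x) (f x0)); lia.
by apply: rotates_to_gap eh => // x y /sA /(bij_inj bf).
Qed.

(** * The union of the pointed rotations *)

(* The order of the rotation of [r] that has [x] as its least element. *)
Definition below (T : eqType) (r : rel T) (x y z : T) : bool :=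
  [|| y == z, y == x | r y x + r z y + r x z < r x y + r y z + r z x].

Section Fan.
Variables (T : finType) (r : rel T).

Definition fan : rel (T * T) := fun p q => (p.1 == q.1) && below r p.1 p.2 q.2.

Hypothesis rT : transitive r.

(** The inequality in [below] says that the cyclic sum is negative, hence -1 by [cyc_bound]. It
    involves only sums of bits and a comparison, which the machine can evaluate. *)
Lemma belowE x y z : below r x y z = [|| y == z, y == x | (cyc r x y z == -1)%R].
Proof.
rewrite /below; congr [|| _, _ | _].
have := cyc_bound x y z rT; rewrite /cyc /gap.
by case: (r x y) (r y x) (r y z) (r z y) (r x z) (r z x) => [] [] [] [] [] [].
Qed.

Lemma cycxxz x z : cyc r x x z = 0%R.
Proof. by rewrite /cyc gapxx (gapC r x z); lia. Qed.

Lemma cycxyx x y : cyc r x y x = 0%R.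
Proof. by rewrite /cyc gapxx (gapC r x y); lia. Qed.

Lemma below_bottom x y : below r x y x = (y == x).
Proof. by rewrite belowE cycxyx orbF orbb. Qed.

Lemma fan_refl : reflexive fan.
Proof. by move=> [x y]; rewrite /fan /= belowE !eqxx. Qed.

Lemma fan_anti : antisymmetric fan.
Proof.
move=> [x y] [x' z]; rewrite /fan /= => /andP[/andP[/eqP <- yz] /andP[_ zy]].
congr (_, _); move: yz zy; rewrite !belowE cycC.
have [//|nyz] := eqVneq y z; rewrite ?eqxx //=.
have [->|nyx] := eqVneq y x; have [->|nzx] := eqVneq z x => //=.
- by rewrite cycxyx.
- by rewrite cycxxz.
- lia.
Qed.

Lemma fan_trans : transitive fan.
Proof.
move=> [x z] [x' y] [x'' u]; rewrite /fan /= => /andP[/eqP -> +] /andP[/eqP <-].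
rewrite eqxx /= !belowE.
have [-> //|nyz] := eqVneq y z.
have [->|nyx] := eqVneq y x; first by rewrite /= !orbT.
have [->|nzu] := eqVneq z u; first by move=> /= ->; rewrite orbT.
have [->|nzx] := eqVneq z x; first by rewrite cycxyx.
(* If [cyc x y z] and [cyc x z u] are -1, the cocycle identity reads [cyc y z u = -2 - cyc x y u],
   and the bounds force [cyc x y u = -1]. *)
have := cyc_cocycle r x y z u; rewrite (cycC r x y u).
have := cyc_bound y z u rT; have := cyc_bound x y u rT => /=; lia.
Qed.

End Fan.

Lemma cyc_isomorphic_at (T U : finType) (r : rel T) (s : rel U) (f : T -> U) x :
  bijective f ->
  (forall y z, cyc s (f x) (f y) (f z) = cyc r x y z) -> cyc_isomorphic r s.
Proof.
move=> bf ef; exists f; split=> // a b c.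
by rewrite (cyc_cocycle s (f x)) !ef -cyc_cocycle.
Qed.

(* Each copy of [T] in the fan is connected through its least element, so an
   isomorphism of fans maps some copy onto a copy. *)
Lemma fan_isomorphicP (T U : finType) (r : rel T) (s : rel U) :
  transitive r -> transitive s ->
  cyc_isomorphic r s <-> isomorphic (fan r) (fan s).
Proof.
move=> rT sT; split=> [[f [bf ef]]|[F [bF eF]]].
  have [g fK gK] := bf.
  exists (fun p => (f p.1, f p.2)); split.
    by exists (fun p => (g p.1, g p.2)) => -[x y] /=; rewrite ?fK ?gK.
  move=> [x y] [x' z]; rewrite /fan /= !belowE // !(bij_eq bf).
  by rewrite ef.
have eqTU : #|T| = #|U|.
  by have := bij_eq_card bF; rewrite !card_prod; nia.
case: (pickP (@predT T)) => [x _|T0]; last first.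
  have U0 : #|U| = 0 by rewrite -eqTU; apply: eq_card0.
  exists (fun x => (F (x, x)).1); split=> [|x]; last by have := T0 x.
  by apply: inj_card_bij => [x|]; [have := T0 x|rewrite eqTU].
have [G FK GK] := bF.
pose f y := (F (x, y)).2; pose x1 := (F (x, x)).1.
have F1 y : F (x, y) = (x1, f y).
  have : fan s (F (x, x)) (F (x, y)) by rewrite -eF /fan /= belowE ?eqxx ?orbT.
  by rewrite /fan /x1 /f => /andP[/eqP-> _]; apply: surjective_pairing.
(* Least elements correspond: the preimage of [(x1, x1)] lies below [(x, x)], hence equals it. *)
have fx : f x = x1.
  have: fan s (x1, x1) (F (x, x)) by rewrite F1 /fan /= belowE ?eqxx ?orbT.
  rewrite -[(x1, x1)]GK -eF /fan /=; case eG: (G _) => [a b] /= /andP[/eqP ea].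
  rewrite ea below_bottom // => /eqP eb; move: (GK (x1, x1)).
  by rewrite eG ea eb F1 => -[].
have injf : injective f.
  by move=> y z eyz; have /(bij_inj bF)[] : F (x, y) = F (x, z) by rewrite !F1 eyz.
have bf : bijective f by apply: inj_card_bij => //; rewrite eqTU.
apply: (@cyc_isomorphic_at _ _ _ _ f x) => // y z.
have eb a b : below r x a b = below s (f x) (f a) (f b).
  by have := eF (x, a) (x, b); rewrite !F1 /fan /= !eqxx fx.
have neg a b : (cyc r x a b == -1)%R = (cyc s (f x) (f a) (f b) == -1)%R.
  have := eb a b; rewrite !belowE // !(inj_eq injf).
  have [-> _|nab] := eqVneq a b.
    by have := cycC r x b b; have := cycC s (f x) (f b) (f b); lia.
  by have [-> _|nax] := eqVneq a x; rewrite ?cycxxz.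
(* [neg] detects the value -1; with [y] and [z] exchanged it detects 1, and [cyc_bound] leaves only
   0. *)
have := neg y z; have := neg z y; rewrite (cycC r) (cycC s).
have := cyc_bound x y z rT; have := cyc_bound (f x) (f y) (f z) sT; lia.
Qed.

(** * Adding isolated points *)

Section Beacon.
Variables (T : finType) (r : rel T).

(* The antichain on the right has more points than the left part, so every
   isomorphism of cyclic structures maps one of its points to such a point, and
   these have gap 0 to everything. *)
Definition beacon_type : finType := (option T + option (option T))%type.

Definition beacon : rel beacon_type := fun u v =>
  match u, v with
  | inl None, inl _ => true
  | inl (Some x), inl (Some y) => r x y
  | inr a, inr b => a == b
  | _, _ => false
  end.

Lemma beacon_refl : reflexive r -> reflexive beacon.
Proof. by move=> rR [[x|]|a] /=. Qed.

Lemma beacon_anti : antisymmetric r -> antisymmetric beacon.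
Proof.
move=> rA [[x|]|a] [[y|]|b] //=; first by move/rA ->.
by case/andP => /eqP ->.
Qed.

Lemma beacon_trans : transitive r -> transitive beacon.
Proof.
move=> rT [[x|]|a] [[y|]|b] [[z|]|c] //=; first exact: rT.
by move/eqP ->.
Qed.

Lemma gap_beacon_inr a v : gap beacon (inr a) v = 0%R.
Proof. by case: v => [[y|]|b]; rewrite /gap //= eq_sym subrr. Qed.

End Beacon.

(** A cyclic sum through an isolated point is the gap of the other two, so once one isolated point
    goes to another, the map preserves all gaps. The least element then tells the points of [T],
    even those isolated in [r], from the antichain. *)
Lemma beacon_isomorphicP (T U : finType) (r : rel T) (s : rel U) :
  reflexive r -> antisymmetric r -> reflexive s -> antisymmetric s ->
  isomorphic r s <-> cyc_isomorphic (beacon r) (beacon s).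
Proof.
move=> rR rA sR sA; split=> [[f [[g fK gK] ef]]|[F [bF eF]]].
  pose lift (V W : Type) (h : V -> W) (u : option V + option (option V)) :=
    match u with
    | inl x => inl (omap h x)
    | inr a => inr (omap (omap h) a)
    end.
  have liftK V W (h : V -> W) h' : cancel h h' -> cancel (lift V W h) (lift W V h').
    by move=> hK [[x|]|[[x|]|]] /=; rewrite ?hK.
  exists (lift T U f); split; first by exists (lift U T g); apply: liftK.
  have eb u v : beacon s (lift T U f u) (lift T U f v) = beacon r u v.
    case: u v => [[x|]|a] [[y|]|b] //=.
    apply: inj_eq; apply: (can_inj (g := omap (omap g))).
    by move=> [[x|]|] /=; rewrite ?fK.
  by move=> x y z; rewrite /cyc /gap !eb.
have eqTU : #|T| = #|U|.
  by have := bij_eq_card bF; rewrite !card_sum !card_option; lia.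
have [a [b Fab]] : exists a b, F (inr a) = inr b.
  case: (pickP (fun a => if F (inr a) is inr _ then true else false)) => [a|noF].
    by case eFa: (F (inr a)) => [//|b] _; exists a, b.
  (* Otherwise the [#|T| + 2] antichain points would inject into the [#|U| + 1] points on the left.
     The default [None] is never reached. *)
  pose G (a : option (option T)) : option U := if F (inr a) is inl x then x else None.
  have FG a : F (inr a) = inl (G a) by have := noF a; rewrite /G; case: (F _).
  have injG : injective G.
    by move=> a a' eG; have /(bij_inj bF)[] : F (inr a) = F (inr a') by rewrite !FG eG.
  by have := leq_card _ injG; rewrite !card_option eqTU ltnn.
have eg u v : gap (beacon s) (F u) (F v) = gap (beacon r) u v.
  have := eF (inr a) u v; rewrite /cyc Fab !(gapC _ (inr _)) !gap_beacon_inr; lia.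
(* [inl (Some x)] has a point strictly below it, hence so has its image; this excludes the least
   element and the antichain. *)
have [f Ff] : exists f : T -> U, forall x, F (inl (Some x)) = inl (Some (f x)).
  suff ex x : exists y, F (inl (Some x)) = inl (Some y) by exact: fin_all_exists ex.
  have := eg (inl None) (inl (Some x)).
  case: (F (inl (Some x))) => [[y|]|c]; first by exists y.
  - by case: (F (inl None)) => [[z|]|c].
  - by rewrite gapC gap_beacon_inr.
have injf : injective f.
  move=> x y eF'; have : F (inl (Some x)) = F (inl (Some y)) by rewrite !Ff eF'.
  by move/(bij_inj bF) => -[].
exists f; split=> [|x y]; first by apply: inj_card_bij => //; rewrite eqTU.
rewrite (le_gap rR rA) (le_gap sR sA) (inj_eq injf); congr (_ || (_ == _)).
by have := eg (inl (Some x)) (inl (Some y)); rewrite !Ff.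
Qed.

(** * Isomorphisms and posets on ordinals *)

Lemma isomorphic_sym (T U : finType) (r : rel T) (s : rel U) :
  isomorphic r s -> isomorphic s r.
Proof.
case=> f [[g fK gK] ef]; exists g; split; first by exists f.
by move=> x y; rewrite ef !gK.
Qed.

Lemma isomorphic_trans (T U V : finType) (r : rel T) (s : rel U) (q : rel V) :
  isomorphic r s -> isomorphic s q -> isomorphic r q.
Proof.
case=> f [bf ef] [g [bg eg]]; exists (g \o f); split; first exact: bij_comp.
by move=> x y; rewrite ef eg.
Qed.

Lemma isomorphic_cyc (T U : finType) (r : rel T) (s : rel U) :
  isomorphic r s -> cyc_isomorphic r s.
Proof. by case=> f [bf ef]; exists f; split=> // x y z; rewrite /cyc /gap !ef. Qed.

Lemma cyc_isomorphic_trans (T U V : finType) (r : rel T) (s : rel U) (q : rel V) :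
  cyc_isomorphic r s -> cyc_isomorphic s q -> cyc_isomorphic r q.
Proof.
case=> f [bf ef] [g [bg eg]]; exists (g \o f); split; first exact: bij_comp.
by move=> x y z; rewrite eg ef.
Qed.

Section Pullback.
Variables (m : nat) (T : finType) (r : rel T) (f : 'I_m -> T).
Hypothesis injf : injective f.
Hypotheses (rR : reflexive r) (rA : antisymmetric r) (rT : transitive r).

Definition pullback : finposet :=
  @FinPoset m (fun i j => r (f i) (f j)) (fun i => rR (f i))
    (fun i j ij => injf (rA ij)) (fun j i k => @rT (f j) (f i) (f k)).

Lemma pullback_isomorphic : m = #|T| -> isomorphic (@le pullback) r.
Proof.
move=> em; exists f; split=> //.
by apply: inj_card_bij => //; rewrite card_ord -em.
Qed.

End Pullback.

Lemma divn_square n (i : 'I_(n * n)) : i %/ n < n.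
Proof. by case: n i => [[]|n] // i; rewrite ltn_divLR. Qed.

Lemma modn_square n (i : 'I_(n * n)) : i %% n < n.
Proof. by case: n i => [[]|n] // i; rewrite ltn_mod. Qed.

Definition divmod n (i : 'I_(n * n)) : 'I_n * 'I_n :=
  (Ordinal (divn_square i), Ordinal (modn_square i)).

Lemma divmod_inj n : injective (@divmod n).
Proof.
move=> i j [ed em]; apply: val_inj => /=.
by rewrite (divn_eq i n) ed em -divn_eq.
Qed.

Definition fan_poset (P : finposet) : finposet :=
  @pullback _ _ (fan (@le P)) _ (@divmod_inj (card P))
    (fan_refl (@le_trans P)) (fan_anti (@le_trans P)) (fan_trans (@le_trans P)).

Lemma fan_poset_isomorphic P : isomorphic (@le (fan_poset P)) (fan (@le P)).
Proof. by apply: pullback_isomorphic; rewrite card_prod card_ord. Qed.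

(** Index 0 is the least element, the indices 1 to n are the points of the poset shifted by one, and
    the remaining n + 2 form the antichain. *)
Definition beacon_index n (i : 'I_(n.+1 + n.+2)) : beacon_type 'I_n :=
  match split i with
  | inl a => inl (unlift ord0 a)
  | inr b => inr (omap (unlift ord0) (unlift ord0 b))
  end.

Lemma unlift_inj n (h : 'I_n) : injective (unlift h).
Proof.
move=> i j; case: (unliftP h i) => [i'|] ->; case: (unliftP h j) => [j'|] -> //.
by move=> [->].
Qed.

Lemma beacon_index_inj n : injective (@beacon_index n).
Proof.
move=> i j e; apply: (can_inj (@splitK _ _)); move: e; rewrite /beacon_index.
case: (split i) (split j) => [a|a] [b|b] // [] e.
  by rewrite (@unlift_inj n.+1 ord0 _ _ e).
by rewrite (@unlift_inj n.+2 ord0 _ _ (inj_omap (@unlift_inj n.+1 ord0) e)).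
Qed.

Definition beacon_poset (P : finposet) : finposet :=
  @pullback _ _ (beacon (@le P)) _ (@beacon_index_inj (card P))
    (beacon_refl (@le_refl P)) (beacon_anti (@le_anti P))
    (beacon_trans (@le_trans P)).

Lemma beacon_poset_isomorphic P :
  isomorphic (@le (beacon_poset P)) (beacon (@le P)).
Proof. by apply: pullback_isomorphic; rewrite card_sum !card_option card_ord. Qed.

(** * Programs *)

Lemma nth_allpairs (S T R : Type) (f : S -> T -> R) s t x0 y0 z0 i j :
  i < size s -> j < size t ->
  nth z0 [seq f x y | x <- s, y <- t] (i * size t + j) =
  f (nth x0 s i) (nth y0 t j).
Proof.
move=> + jt; elim: s i => [|x s IHs] [|i] //= si; rewrite nth_cat size_map.
  by rewrite jt (nth_map y0).
by rewrite mulSn -addnA ltnNge leq_addr /= addKn IHs.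
Qed.

Definition order_matrix (P : finposet) : seq bool :=
  [seq le x y | x <- enum 'I_(card P), y <- enum 'I_(card P)].

Lemma size_order_matrix P : size (order_matrix P) = card P * card P.
Proof. by rewrite size_allpairs size_enum_ord. Qed.

Definition nat_le (P : finposet) (i j : nat) : bool :=
  nth false (order_matrix P) (i * card P + j).

Lemma nat_leE P (i j : 'I_(card P)) : nat_le P i j = le i j.
Proof.
rewrite /nat_le -[in X in _ * X](size_enum_ord (card P)).
by rewrite (nth_allpairs _ i i) ?size_enum_ord // !nth_ord_enum.
Qed.

Lemma encode_posetE (P : finposet) (F : rel nat) :
  (forall i j : 'I_(card P), le i j = F i j) ->
  encode_poset P = nseq (card P) true ++ false ::
    [seq F i j | i <- iota 0 (card P), j <- iota 0 (card P)].
Proof.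
move=> eF; rewrite /encode_poset -val_enum_ord allpairs_mapl allpairs_mapr.
congr (_ ++ _ :: _); apply: eq_allpairs => x y; exact: eF.
Qed.

(** * Program correctness with time bounds *)

Section Runs.
Variable w : seq bool.

(** A Hoare triple for total correctness, with a time bound. *)
Definition runs (c : cmd) (s : state) (T : nat) (Q : state -> Prop) : Prop :=
  exists t s', [/\ exec w c s t s', t <= T & Q s'].

Lemma runs_weaken c s T T' (Q Q' : state -> Prop) :
  runs c s T Q -> T <= T' -> (forall s', Q s' -> Q' s') -> runs c s T' Q'.
Proof.
case=> t [s' [ex le_t Qs']] TT' QQ'; exists t, s'; split=> //.
- exact: leq_trans TT'.
- exact: QQ'.
Qed.

Lemma runs_leq c s T T' (Q : state -> Prop) :
  runs c s T Q -> T <= T' -> runs c s T' Q.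
Proof. by move=> rT TT'; apply: runs_weaken rT TT' _. Qed.

Lemma runs_seq c1 c2 s T1 T2 (Q1 Q : state -> Prop) :
  runs c1 s T1 Q1 -> (forall s', Q1 s' -> runs c2 s' T2 Q) ->
  runs (Seq c1 c2) s (T1 + T2) Q.
Proof.
case=> t1 [s1 [ex1 le1 Q1s1]] /(_ _ Q1s1)[t2 [s2 [ex2 le2 Qs2]]].
exists (t1 + t2), s2; split=> //; [exact: ExecSeq ex1 ex2 | exact: leq_add].
Qed.

(** [I k] holds after [k] rounds, and there are exactly [L] of them. Each round pays one step for
    its test; the failing test is the final 1. *)
Lemma runs_while (I : nat -> state -> Prop) L T x c s :
  I 0 s ->
  (forall k s', k < L -> I k s' -> 0 < mem s' x /\ runs c s' T (I k.+1)) ->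
  (forall s', I L s' -> mem s' x = 0) ->
  runs (While x c) s (L * T.+1 + 1) (I L).
Proof.
move=> I0 IS IL.
suff loop d k s' : k + d = L -> I k s' -> runs (While x c) s' (d * T.+1 + 1) (I L).
  exact: (loop L 0).
elim: d k s' => [|d IHd] k s' ekd Ik.
  rewrite addn0 in ekd; exists 1, s'; split=> //; last by rewrite -ekd.
  by apply/ExecWhileF/IL; rewrite -ekd.
have [x0 [t1 [s1 [ex1 le1 I1]]]] : 0 < mem s' x /\ runs c s' T (I k.+1).
  by apply: IS => //; lia.
have [|t2 [s2 [ex2 le2 I2]]] := IHd k.+1 s1 _ I1; first by lia.
exists (t1 + t2).+1, s2; split=> //; first exact: ExecWhileT ex1 ex2.
by lia.
Qed.

(** Loop-free programs are run by a function, so that their effect is found by simplification and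
    only loops need an invariant. *)
Fixpoint loop_free c : bool :=
  match c with
  | Seq c1 c2 | If _ c1 c2 => loop_free c1 && loop_free c2
  | While _ _ => false
  | _ => true
  end.

Fixpoint cost c : nat :=
  match c with
  | Seq c1 c2 => cost c1 + cost c2
  | If _ c1 c2 => (cost c1 + cost c2).+1
  | _ => 1
  end.

Fixpoint run c s : state :=
  match c with
  | Const x v => set_cell s x v
  | Add x y z => set_cell s x (mem s y + mem s z)
  | Sub x y z => set_cell s x (mem s y - mem s z)
  | Fetch x y => set_cell s x (mem s (mem s y))
  | Store x y => set_cell s (mem s x) (mem s y)
  | Read x y => set_cell s x (read w (mem s y))
  | Write b => State (mem s) (rcons (out s) b)
  | Seq c1 c2 => run c2 (run c1 s)
  | If x c1 c2 => if 0 < mem s x then run c1 s else run c2 s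
  | While _ _ => s
  end.

Lemma exec_run c s :
  loop_free c -> exists2 t, exec w c s t (run c s) & t <= cost c.
Proof.
elim: c s => //= [x v|x y z|x y z|x y|x y|x y|b|c1 IH1 c2 IH2|x c1 IH1 c2 IH2] s.
1-7: by exists 1 => //; constructor.
  case/andP => /(IH1 s)[t1 ex1 le1] /(IH2 (run c1 s))[t2 ex2 le2].
  by exists (t1 + t2); [exact: ExecSeq ex1 ex2 | exact: leq_add].
case/andP => /(IH1 s)[t1 ex1 le1] /(IH2 s)[t2 ex2 le2].
case: ltnP => [x0|]; last rewrite leqn0 => /eqP x0.
  by exists t1.+1; [exact: ExecIfT | lia].
by exists t2.+1; [exact: ExecIfF | lia].
Qed.

Lemma runs_run c s T (Q : state -> Prop) :
  loop_free c -> cost c <= T -> Q (run c s) -> runs c s T Q.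
Proof.
move=> /(exec_run s)[t ex le_t] le_T Qs.
by exists t, (run c s); split=> //; apply: leq_trans le_T.
Qed.

End Runs.

Definition frame (m : nat) (s s' : state) : Prop :=
  out s' = out s /\ forall k, k < m -> mem s' k = mem s k.

Lemma frame_trans m s1 s2 s3 : frame m s1 s2 -> frame m s2 s3 -> frame m s1 s3.
Proof.
by case=> o12 m12 [o23 m23]; split=> [|k km]; rewrite ?o23 ?m23 ?m12.
Qed.

Lemma frame_leq m m' s s' : m <= m' -> frame m' s s' -> frame m s s'.
Proof. by move=> mm' [o f]; split=> // k km; apply/f/(leq_trans km). Qed.

Lemma frame_set m s s' x v : m <= x -> frame m s s' -> frame m s (set_cell s' x v).
Proof.
by move=> mx [o f]; split=> // k km /=; rewrite ltn_eqF ?f // (leq_trans km).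
Qed.

Notation "c1 ;; c2" := (Seq c1 c2) (at level 60, right associativity).

Definition Copy d x := Const d 0;; Add d d x.

Lemma runs_init_while w (I : nat -> state -> Prop) L T T0 c0 x c s :
  runs w c0 s T0 (I 0) ->
  (forall k s', k < L -> I k s' -> 0 < mem s' x /\ runs w c s' T (I k.+1)) ->
  (forall s', I L s' -> mem s' x = 0) ->
  runs w (c0;; While x c) s (T0 + (L * T.+1 + 1)) (I L).
Proof. by move=> r0 IS IL; apply: runs_seq r0 _ => s' I0; apply: runs_while. Qed.

Definition Mul : cmd :=
  (Const 22 0;; Copy 23 20);; While 23 (Add 22 22 21;; Sub 23 23 0).

Lemma runs_Mul w s : mem s 0 = 1 ->
  runs w Mul s (3 * mem s 20 + 4)
    (fun s' => frame 20 s s' /\ mem s' 22 = mem s 20 * mem s 21).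
Proof.
move=> s0.
pose I k s' := [/\ frame 20 s s', mem s' 21 = mem s 21,
  mem s' 22 = k * mem s 21 & mem s' 23 = mem s 20 - k].
apply: (@runs_weaken _ _ _ (3 + (mem s 20 * 3 + 1)) _ (I (mem s 20))).
- apply: runs_init_while => [|k s' kX [fr m21 m22 m23]|s' [_ _ _ ->]]; last first.
  + by rewrite subnn.
  + split; first by rewrite m23 subn_gt0.
    apply: runs_run => //; split; rewrite /= ?m21 ?m22 ?m23 ?fr.2 ?s0 //; try lia.
    by do !apply: frame_set.
  + apply: runs_run => //; split; rewrite /= ?subn0 //.
    by do !apply: frame_set.
- by lia.
- by move=> s' [].
Qed.

(** Repeated subtraction of [X_2] from [X_20]. The guard [X_24] is the truncated [X_22 + 1 - X_2],
    positive exactly when another subtraction fits. [X_23] keeps quotient times divisor, which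
    serves as a row offset. *)
Definition DivMod : cmd :=
  (Const 21 0;; Const 23 0;; Copy 22 20;; Add 24 22 0;; Sub 24 24 2);;
  While 24 (Sub 22 22 2;; Add 21 21 0;; Add 23 23 2;; Add 24 22 0;; Sub 24 24 2).

Lemma runs_DivMod w s : mem s 0 = 1 -> 0 < mem s 2 ->
  runs w DivMod s (6 * (mem s 20 %/ mem s 2) + 7)
    (fun s' => [/\ frame 20 s s', mem s' 21 = mem s 20 %/ mem s 2,
       mem s' 22 = mem s 20 %% mem s 2
     & mem s' 23 = mem s 20 %/ mem s 2 * mem s 2]).
Proof.
set X := mem s 20; set n := mem s 2; move=> s0 n0.
pose I k s' := [/\ frame 20 s s', mem s' 21 = k, mem s' 22 = X - k * n,
  mem s' 23 = k * n & mem s' 24 = X - k * n + 1 - n].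
have divX := divn_eq X n; have modX := ltn_pmod X n0.
apply: (@runs_weaken _ _ _ (6 + (X %/ n * 6 + 1)) _ (I (X %/ n))).
- apply: runs_init_while => [|k s' kX [fr m21 m22 m23 m24]|s' [_ _ _ _ ->]]; last first.
  + by lia.
  + have kn : k.+1 * n <= X %/ n * n by rewrite leq_mul2r kX orbT.
    rewrite mulSn in kn.
    split; first by rewrite m24; lia.
    apply: runs_run => //.
    split; rewrite /= ?m21 ?m22 ?m23 ?fr.2 ?s0 -/n // ?mulSn; try lia.
    by do !apply: frame_set.
  + apply: runs_run => //; split; rewrite /= ?s0 ?subn0 ?addn0 //.
    by do !apply: frame_set.
- by lia.
- by move=> s' [fr -> -> -> _]; split=> //; lia.
Qed.

Section For.
Variables (w : seq bool) (i : nat).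

(** [X_7] is recomputed after each round, so the body, an inner loop included, may overwrite it. *)
Definition For (c : cmd) : cmd :=
  (Const i 0;; Copy 7 3);; While 7 (c;; Add i i 0;; Copy 7 3;; Sub 7 7 i).

Lemma runs_For (I : nat -> state -> Prop) N T c s :
  3 < i < 6 -> mem s 0 = 1 -> mem s 3 = N ->
  (forall k s' x v, x = i \/ x = 7 -> I k s' -> I k (set_cell s' x v)) ->
  (forall k s', k < N -> mem s' i = k -> mem s' 0 = 1 -> mem s' 3 = N -> I k s' ->
     runs w c s' T (fun s'' => [/\ mem s'' i = k, mem s'' 0 = 1, mem s'' 3 = N
                                  & I k.+1 s''])) ->
  I 0 s -> runs w (For c) s (N * (T + 5) + 4) (I N).
Proof.
move=> /andP[i3 i6] s0 s3 Iset IS I0.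
have ne : ((0 == i) = false) * ((3 == i) = false) * ((i == 7) = false) * ((7 == i) = false).
  by do !split; apply/eqP; lia.
pose J k s' := [/\ mem s' i = k, mem s' 0 = 1, mem s' 3 = N,
  mem s' 7 = N - k & I k s'].
apply: (@runs_weaken _ _ _ (3 + (N * (T + 4).+1 + 1)) _ (J N)).
- apply: runs_init_while => [|k s' kN [mi m0 m3 m7 Ik]|s' [_ _ _ -> _]]; last first.
  + by rewrite subnn.
  + split; first by rewrite m7 subn_gt0.
    apply: runs_seq; first by apply: (IS k).
    move=> s1 [mi1 m01 m31 I1]; apply: runs_run => //.
    split; rewrite /= ?(ne, eqxx) /= ?mi1 ?m01 ?m31 //; try lia.
    by do !apply: (Iset); auto.
  + apply: runs_run => //; split; rewrite /= ?(ne, eqxx) /= ?ne ?subn0 ?add0n //.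
    by do !apply: (Iset); auto.
- by lia.
- by move=> s' [].
Qed.

End For.

(** * Reading and writing encoded posets *)

Lemma read_cat pre v k : read (pre ++ v) (size pre + k) = read v k.
Proof. by rewrite /read map_cat nth_cat size_map ltnNge leq_addr /= addKn. Qed.

Lemma read_unary n v k :
  k <= n -> read (nseq n true ++ false :: v) k = (k < n).+1.
Proof.
rewrite /read map_cat map_nseq nth_cat size_nseq leq_eqVlt => /predU1P[->|kn].
  by rewrite ltnn subnn.
by rewrite kn nth_nseq kn.
Qed.

Lemma read_order_matrix P post x y : x < card P -> y < card P ->
  read (order_matrix P ++ post) (x * card P + y) = (nat_le P x y).+1.
Proof.
move=> xP yP; have lt_xy : x * card P + y < size (order_matrix P).
  by rewrite size_order_matrix; nia.
rewrite /read map_cat nth_cat size_map lt_xy (nth_map false) //.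
Qed.

(** Bits are read as 1 and 2, so [X_7] is 1 on the unary part and 0 on the end mark, which the last
    instruction skips. *)
Definition Count : cmd :=
  ((Const 2 0;; Read 7 1;; Sub 7 7 0);;
   While 7 (Add 2 2 0;; Add 1 1 0;; Read 7 1;; Sub 7 7 0));; Add 1 1 0.

Lemma runs_Count pre n post s :
  mem s 0 = 1 -> mem s 1 = size pre ->
  runs (pre ++ nseq n true ++ false :: post) Count s (5 * n + 5)
    (fun s' => [/\ mem s' 0 = 1, mem s' 1 = size pre + n.+1, mem s' 2 = n
                 & out s' = out s]).
Proof.
move=> s0 s1.
pose I k s' := [/\ mem s' 0 = 1, mem s' 1 = size pre + k, mem s' 2 = k,
  mem s' 7 = (k < n) & out s' = out s].
apply: (@runs_leq _ _ _ (3 + (n * 5 + 1) + 1)); last by lia.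
apply: (@runs_seq _ _ _ _ _ _ (I n)) => [|s' [m0 m1 m2 m7 o]]; last first.
  by apply: runs_run => //=; split; rewrite ?m0 ?m1 ?m2 //; lia.
apply: (@runs_init_while _ I) => [|k s' kn [m0 m1 m2 m7 o]|s' [_ _ _ -> _]]; last first.
- by rewrite ltnn.
- split; first by rewrite m7 kn.
  apply: runs_run => //=; split; rewrite /= ?m0 ?m1 ?m2 ?addn1 ?addnS //.
  by rewrite -addnS read_cat read_unary //; lia.
- apply: runs_run => //=; split; rewrite /= ?s0 ?s1 ?addn0 //.
  by rewrite -[size pre]addn0 read_cat read_unary //; lia.
Qed.

(* Register conventions: X_0 = 1, X_1 is the current position in the input,
   X_2 = n is the size of the poset being read, X_3 = N n that of the poset being
   written, X_4 and X_5 are a row and a column of the latter, and X_6 receives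
   the entry there. The temporary X_7 is free, and so is everything above. *)
Section Print.
Variables (cN cb : cmd) (N : nat -> nat) (F : nat -> rel nat -> rel nat) (K : nat).

Definition computes_card : Prop := forall w s, mem s 0 = 1 ->
  runs w cN s (K * (mem s 2).+1)
    (fun s' => frame 3 s s' /\ mem s' 3 = N (mem s 2)).

Definition computes_entry : Prop := forall w (M : rel nat) s n, mem s 0 = 1 ->
  mem s 2 = n ->
  (forall x y, x < n -> y < n -> read w (mem s 1 + (x * n + y)) = (M x y).+1) ->
  mem s 4 < N n -> mem s 5 < N n ->
  runs w cb s (K * n.+1)
    (fun s' => frame 6 s s' /\ (0 < mem s' 6) = F n M (mem s 4) (mem s 5)).

(** The closing multiplication moves [X_1] past the n^2 matrix entries, to where the next poset
    begins. *)
Definition Print : cmd :=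
  Count;; cN;; For 4 (Write true);; Write false;;
  For 4 (For 5 (cb;; If 6 (Write true) (Write false)));;
  (Copy 20 2;; Copy 21 2);; Mul;; Add 1 1 22.

Hypotheses (cNP : computes_card) (cbP : computes_entry).
Hypothesis N_bound : forall n, N n <= 3 * n.+1 ^ 2.

Variable f : finposet -> finposet.
Hypothesis card_f : forall P, card (f P) = N (card P).
Hypothesis le_f : forall P (i j : 'I_(card (f P))), le i j = F (card P) (nat_le P) i j.

Lemma runs_unary w s : mem s 0 = 1 ->
  runs w (For 4 (Write true)) s (mem s 3 * 6 + 4)
    (fun s' => [/\ forall k, k < 4 -> mem s' k = mem s k
                 & out s' = out s ++ nseq (mem s 3) true]).
Proof.
move=> s0.
pose I l s' := [/\ forall k, k < 4 -> mem s' k = mem s k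
                 & out s' = out s ++ nseq l true].
apply: (@runs_For _ _ I _ 1) => // [l s' x v [->|->] [m o]|l s' lN i0 m0 m3 [m o]|].
- by split=> // k k4 /=; rewrite ltn_eqF ?m.
- by split=> // k k4 /=; rewrite ltn_eqF ?m // (leq_trans k4).
- apply: runs_run => //; split=> //; split=> //.
  by rewrite -addn1 nseqD catA -o /= cats1.
- by split=> //; rewrite cats0.
Qed.

Lemma runs_entries w (M : rel nat) s n : mem s 0 = 1 -> mem s 2 = n -> mem s 3 = N n ->
  (forall x y, x < n -> y < n -> read w (mem s 1 + (x * n + y)) = (M x y).+1) ->
  runs w (For 4 (For 5 (cb;; If 6 (Write true) (Write false)))) s
    (N n * (N n * (K * n.+1 + 8) + 9) + 4)
    (fun s' => [/\ forall k, k < 4 -> mem s' k = mem s k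
       & out s' = out s ++ [seq F n M i j | i <- iota 0 (N n), j <- iota 0 (N n)]]).
Proof.
move=> s0 s2 s3 rM.
pose I l s' := [/\ forall k, k < 4 -> mem s' k = mem s k
  & out s' = out s ++ [seq F n M i j | i <- iota 0 l, j <- iota 0 (N n)]].
apply: (@runs_leq _ _ _ (N n * (N n * (K * n.+1 + 3 + 5) + 4 + 5) + 4));
  last by rewrite -!addnA.
apply: (@runs_For _ _ I) => // [l s' x v [->|->] [m o]|l s' lN i0 m0 m3 [m o]|].
- by split=> // k k4 /=; rewrite ltn_eqF ?m.
- by split=> // k k4 /=; rewrite ltn_eqF ?m // (leq_trans k4).
(* The row number in [X_4] must survive the inner loop, hence the bound 5 instead of 4. *)
- pose J p s'' := [/\ forall k, k < 5 -> mem s'' k = mem s' k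
    & out s'' = out s' ++ [seq F n M l j | j <- iota 0 p]].
  apply: (@runs_weaken _ _ _ (N n * (K * n.+1 + 3 + 5) + 4) _ (J (N n))) => // [|s'' [mm o2]].
  + apply: (@runs_For _ _ J) => // [p t x v [->|->] [mm o2]|p t pN j0 t0 t3 [mm o2]|].
    * by split=> // k k4 /=; rewrite ltn_eqF ?mm.
    * by split=> // k k4 /=; rewrite ltn_eqF ?mm // (leq_trans k4).
    * have t1 : mem t 1 = mem s 1 by rewrite mm ?m.
      have t2 : mem t 2 = n by rewrite mm ?m.
      have t4 : mem t 4 = l by rewrite mm.
      apply: runs_seq; first by apply: cbP => //; rewrite ?t1 ?t4 ?j0 //; exact: rM.
      rewrite t4 j0 => t' [[ot ft] Ft].
      have mm' k : k < 5 -> mem t' k = mem s' k by move=> k5; rewrite ft ?mm //; lia.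
      have oJ : out s' ++ [seq F n M l j | j <- iota 0 p.+1] = rcons (out t') (F n M l p).
        by rewrite -addn1 iotaD map_cat catA /= cats1 -o2 ot.
      apply: runs_run => //; rewrite /J {J o2}oJ /= Ft.
      by case: (F n M l p); split; rewrite /= ?ft.
    * by split=> //; rewrite cats0.
  + split; rewrite ?mm ?i0 //; split=> [k k4|]; first by rewrite mm ?m // ltnW.
    by rewrite o2 o -[l.+1]addn1 iotaD allpairs_cat -catA /= cats0 add0n.
- by split=> //; rewrite cats0.
Qed.

(** At most 9 (n + 1)^4 entries are written, each in time O(n), whence the exponent 5. The context
    [pre], [post] allows for either poset of a pair. *)
Lemma runs_Print P pre post s :
  mem s 0 = 1 -> mem s 1 = size pre ->
  runs (pre ++ encode_poset P ++ post) Print s ((10 * K + 200) * (card P).+1 ^ 5)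
    (fun s' => [/\ mem s' 0 = 1, mem s' 1 = size (pre ++ encode_poset P)
                 & out s' = out s ++ encode_poset (f P)]).
Proof.
set n := card P; move=> s0 s1.
have -> : pre ++ encode_poset P ++ post =
          pre ++ nseq n true ++ false :: (order_matrix P ++ post).
  by rewrite /encode_poset -!catA.
have -> : size (pre ++ encode_poset P) = size pre + n.+1 + n * n.
  by rewrite size_cat /encode_poset size_cat /= size_nseq size_order_matrix; lia.
rewrite (encode_posetE (@le_f P)) card_f -/n.
set w := pre ++ _.
have rM x y : x < n -> y < n ->
    read w (size pre + n.+1 + (x * n + y)) = (nat_le P x y).+1.
  move=> xn yn; rewrite -(read_order_matrix post xn yn) /w -cat_rcons catA.
  have -> : size pre + n.+1 = size (pre ++ rcons (nseq n true) false).
    by rewrite size_cat size_rcons size_nseq.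
  exact: read_cat.
apply: runs_leq.
  apply: runs_seq; first exact: runs_Count.
  move=> a [a0 a1 a2 oa].
  have := cNP w a0; rewrite a2 => rN; apply: runs_seq rN _ => b [[ob fb] b3].
  have b0 : mem b 0 = 1 by rewrite fb.
  have := runs_unary w b0; rewrite b3 => ru.
  apply: runs_seq ru _ => c [fc oc].
  apply: runs_seq.
    by apply: (@runs_run _ _ _ 1 (eq (State (mem c) (rcons (out c) false)))).
  move=> _ <-; set c' := State _ _.
  have c0 : mem c' 0 = 1 by rewrite /= fc.
  have c1 : mem c' 1 = size pre + n.+1 by rewrite /= fc // fb.
  have c2 : mem c' 2 = n by rewrite /= fc // fb.
  have c3 : mem c' 3 = N n by rewrite /= fc // b3.
  have rM' x y : x < n -> y < n -> read w (mem c' 1 + (x * n + y)) = (nat_le P x y).+1.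
    by rewrite c1; apply: rM.
  apply: runs_seq; first exact: runs_entries c0 c2 c3 rM'.
  move=> d [fd od].
  pose e := set_cell (set_cell (set_cell (set_cell d 20 0) 20 n) 21 0) 21 n.
  apply: runs_seq; first apply: (@runs_run _ _ _ 4 (eq e)) => //.
    by rewrite /= fd // c2 !add0n.
  move=> _ <-; have := @runs_Mul w e; rewrite /= fd // => /(_ c0) rm.
  apply: runs_seq rm _ => g [[og fg] g22].
  apply: (@runs_run _ _ _ 1) => //; split.
  - by rewrite /= fg //= fd.
  - by rewrite /= g22 fg //= fd // c1.
  - by rewrite /= og /= od /= oc ob oa -cats1 -!catA.
(* All powers of [u] are bounded by [u5] and all products with [K] by multiples of [K * u5], which
   leaves a linear inequality. *)
have := N_bound n; set u := n.+1; set v := N n; set u5 := u ^ 5 => le_v.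
have le_u k : k <= 5 -> u ^ k <= u5 by move=> k5; rewrite leq_pexp2l.
have le_vv : v * v <= 9 * u ^ 4.
  by have := leq_mul le_v le_v; rewrite mulnACA -expnD.
have le_vvu : v * v * u <= 9 * u5.
  by have := leq_mul le_vv (leqnn u); rewrite -[9 * _ * _]mulnA -expnSr.
have u2 := le_u 2 isT; have u4 := le_u 4 isT; have u1 := le_u 1 isT.
have u0 := le_u 0 isT; rewrite expn1 expn0 in u1 u0.
have le_K : K * (v * v * u) <= 9 * (K * u5) by rewrite [9 * _]mulnCA leq_mul2l le_vvu orbT.
have le_Ku : K * u <= K * u5 by rewrite leq_mul2l u1 orbT.
have -> : v * (v * (K * u + 8) + 9) = K * (v * v * u) + 8 * (v * v) + 9 * v by lia.
have nu : n <= u by apply: leqnSn.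
lia.
Qed.

End Print.

Lemma polytime_computable_pair (cN cb : cmd) (N : nat -> nat)
    (F : nat -> rel nat -> rel nat) (K : nat) (f : finposet -> finposet) :
  computes_card cN N K -> computes_entry cb N F K ->
  (forall n, N n <= 3 * n.+1 ^ 2) ->
  (forall P, card (f P) = N (card P)) ->
  (forall P (i j : 'I_(card (f P))), le i j = F (card P) (nat_le P) i j) ->
  polytime_computable encode_pair encode_pair (fun PQ => (f PQ.1, f PQ.2)).
Proof.
move=> cNP cbP leN card_f le_f; pose B := 10 * K + 200.
exists (Const 0 1;; Print cN cb;; Print cN cb), (2 * B + 1), 5 => -[P Q].
set w := encode_pair (P, Q).
(* The ground set size is encoded in unary, so a polynomial in it is bounded by one in the input
   length. *)
have size_w R : R \in [:: card P; card Q] -> R.+1 <= size w.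
  rewrite /w /encode_pair /encode_poset !size_cat /= !size_nseq !inE.
  by case/predU1P => [->|/eqP ->]; lia.
suff [t [s [ex le_t os]]] : runs w (Const 0 1;; Print cN cb;; Print cN cb) init
    (1 + (B * (card P).+1 ^ 5 + B * (card Q).+1 ^ 5))
    (fun s => out s = encode_pair (f P, f Q)).
  exists t, s; split=> //; apply: leq_trans le_t _.
  have e5 R : R \in [:: card P; card Q] -> B * R.+1 ^ 5 <= B * size w ^ 5.
    by move=> Rin; rewrite leq_mul2l leq_exp2r ?size_w ?orbT.
  have := e5 (card P) (mem_head _ _); have := e5 (card Q) _.
  by rewrite !inE eqxx orbT => /(_ isT) /=; lia.
apply: runs_seq; first by apply: (@runs_run _ _ _ 1 (eq (set_cell init 0 1))).
move=> _ <-; apply: runs_seq.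
  by apply: (@runs_Print _ _ _ _ _ cNP cbP leN f card_f le_f P [::] (encode_poset Q)).
move=> s [s0 s1 os].
have := @runs_Print _ _ _ _ _ cNP cbP leN f card_f le_f Q (encode_poset P) [::] s s0 s1.
rewrite cats0 => rQ; apply: runs_weaken rQ _ _ => // s' [_ _ ->].
by rewrite os.
Qed.

(** * The two reductions *)

(** At least one of the two truncated differences vanishes, so their sum is the distance of the two
    numbers. *)
Definition Neq d x y : cmd := Sub d x y;; Sub 7 y x;; Add d d 7.

Definition fan_card : cmd := (Copy 20 2;; Copy 21 2);; Mul;; Copy 3 22.

Lemma runs_fan_card : computes_card fan_card (fun n => n * n) 100.
Proof.
move=> w s s0; set n := mem s 2.
pose e := set_cell (set_cell (set_cell (set_cell s 20 0) 20 n) 21 0) 21 n.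
apply: runs_leq.
  apply: runs_seq; first by apply: (@runs_run _ _ _ 4 (eq e)).
  move=> _ <-; apply: runs_seq; first exact: runs_Mul.
  move=> g [[og fg] g22]; apply: (@runs_run _ _ _ 2) => //; split; last by rewrite /= g22.
  do !apply: frame_set => //; split=> [|k k3]; first by rewrite og.
  by rewrite fg ?(leq_trans k3) //=; case: k k3 => [|[|[|]]].
by rewrite /=; lia.
Qed.

(* X_p holds a row offset, that is, a row index times X_2. The value read is 1
   plus the bit; three of them are added to each side of the comparison in
   [below], so the excess cancels. *)
Definition Look a p q : cmd := Add 7 1 p;; Add 7 7 q;; Read 7 7;; Add a a 7.

Definition fan_tests : cmd :=
  Const 15 0;; Const 16 0;;
  Look 15 9 10;; Look 15 13 12;; Look 15 14 8;;
  Look 16 13 8;; Look 16 14 10;; Look 16 9 12;;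
  Neq 17 8 11;; Neq 18 10 12;; Neq 19 10 8.

(** [X_17], [X_18], [X_19] are positive when x and x', y and z, y and x differ. The truncated
    [X_15 - X_16] is positive exactly when the inequality in [below] holds. *)
Definition fan_decision : cmd :=
  If 17 (Const 6 0)
    (If 18 (If 19 (Sub 6 15 16) (Const 6 1)) (Const 6 1)).

(* For i = x n + y and j = x' n + z this leaves x, x n, y, x', z, y n, z n in
   X_8, ..., X_14. *)
Definition fan_entry : cmd :=
  Copy 20 4;; DivMod;;
  (Copy 8 21;; Copy 10 22;; Copy 9 23;; Copy 20 5);; DivMod;;
  (Copy 11 21;; Copy 12 22;; Copy 20 10;; Copy 21 2);; Mul;;
  (Copy 13 22;; Copy 20 12;; Copy 21 2);; Mul;;
  Copy 14 22;; fan_tests;; fan_decision.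

Definition fan_le n (M : rel nat) : rel nat := fun i j =>
  (i %/ n == j %/ n) && below M (i %/ n) (i %% n) (j %% n).

Lemma neq_nat_subn (x y : nat) : (0 < x - y + (y - x)) = (x != y).
Proof. lia. Qed.

Lemma runs_fan_tests w (M : rel nat) n x y z x' s :
  (forall i j, i < n -> j < n -> read w (mem s 1 + (i * n + j)) = (M i j).+1) ->
  x < n -> y < n -> z < n ->
  mem s 8 = x -> mem s 9 = x * n -> mem s 10 = y -> mem s 11 = x' ->
  mem s 12 = z -> mem s 13 = y * n -> mem s 14 = z * n ->
  runs w (fan_tests;; fan_decision) s 50
    (fun s' => frame 6 s s' /\ (0 < mem s' 6) = (x == x') && below M x y z).
Proof.
move=> rM xn yn zn s8 s9 s10 s11 s12 s13 s14.
pose Q s' := [/\ frame 6 s s', mem s' 15 = M x y + M y z + M z x + 3,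
  mem s' 16 = M y x + M z y + M x z + 3 &
  [/\ (0 < mem s' 17) = (x != x'), (0 < mem s' 18) = (y != z)
    & (0 < mem s' 19) = (y != x)]].
apply: (@runs_leq _ _ _ (40 + 7)) => //.
apply: (@runs_seq _ _ _ _ _ _ Q) => [|s' [fr m15 m16 [m17 m18 m19]]].
  apply: runs_run => //; split.
  - by do !apply: frame_set.
  - by rewrite /= !add0n s9 s10 s12 s13 s14 s8 -!addnA !rM //; lia.
  - by rewrite /= !add0n s9 s10 s12 s13 s14 s8 -!addnA !rM //; lia.
  - by rewrite /= s8 s10 s11 s12 !neq_nat_subn.
apply: runs_run => //; split; first by rewrite /=; do !case: ifP => _; apply: frame_set.
rewrite /= m17 m18 m19 /below; case: eqP => //= _; case: eqP => //= _.
by case: eqP => //= _; rewrite m15 m16 subn_gt0 ltn_add2r.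
Qed.

(** The quotients and the factors in [X_20] are below n, so the two divisions and two
    multiplications take time O(n). *)
Lemma runs_fan_entry : computes_entry fan_entry (fun n => n * n) fan_le 100.
Proof.
move=> w M s n s0 s2 rM i_lt j_lt; set i := mem s 4; set j := mem s 5.
have n0 : 0 < n by case: (n) i_lt.
have xn : i %/ n < n by rewrite ltn_divLR.
have x'n : j %/ n < n by rewrite ltn_divLR.
have yn : i %% n < n by rewrite ltn_mod.
have zn : j %% n < n by rewrite ltn_mod.
apply: runs_leq.
  apply: runs_seq; first by apply: (@runs_run _ _ _ 2 (eq (set_cell (set_cell s 20 0) 20 i))).
  move=> _ <-; set e := set_cell _ _ _.
  have := @runs_DivMod w e s0; rewrite /= s2 => /(_ n0) r.
  apply: runs_seq r _ => a [[oa fa] a21 a22 a23].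
  pose Q1 b := [/\ frame 8 a b, mem b 8 = i %/ n, mem b 10 = i %% n,
    mem b 9 = i %/ n * n & mem b 20 = j].
  apply: (@runs_seq _ _ _ _ 8 _ Q1).
    apply: runs_run => //; split; rewrite /= ?a21 ?a22 ?a23 ?fa //.
    by do !apply: frame_set.
  move=> b [[ob fb] b8 b10 b9 b20].
  have b0 : mem b 0 = 1 by rewrite fb // fa.
  have b2 : mem b 2 = n by rewrite fb // fa.
  have := @runs_DivMod w b b0; rewrite b2 b20 => /(_ n0) r.
  apply: runs_seq r _ => c [[oc fc] c21 c22 c23].
  pose Q2 d := [/\ frame 11 c d, mem d 11 = j %/ n, mem d 12 = j %% n,
    mem d 20 = i %% n & mem d 21 = n].
  apply: (@runs_seq _ _ _ _ 8 _ Q2).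
    apply: runs_run => //; split; rewrite /= ?c21 ?c22 ?fc //.
    by do !apply: frame_set.
  move=> d [[od fd] d11 d12 d20 d21].
  have d0 : mem d 0 = 1 by rewrite fd // fc.
  have := @runs_Mul w d d0; rewrite d20 d21 => r.
  apply: runs_seq r _ => g [[og fg] g22].
  pose Q3 h := [/\ frame 13 g h, mem h 13 = i %% n * n, mem h 20 = j %% n & mem h 21 = n].
  apply: (@runs_seq _ _ _ _ 6 _ Q3).
    have g2 : mem g 2 = n by rewrite fg // fd // fc.
    have g12 : mem g 12 = j %% n by rewrite fg.
    apply: runs_run => //; split; rewrite /= ?g22 ?g12 ?g2 //.
    by do !apply: frame_set.
  move=> h [[oh fh] h13 h20 h21].
  have h0 : mem h 0 = 1 by rewrite fh // fg.
  have := @runs_Mul w h h0; rewrite h20 h21 => r.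
  apply: runs_seq r _ => p [[op fp] p22].
  pose Q4 q := frame 14 p q /\ mem q 14 = j %% n * n.
  apply: (@runs_seq _ _ _ _ 2 _ Q4).
    apply: runs_run => //; split; rewrite /= ?p22 //.
    by do !apply: frame_set.
  move=> q [[oq fq] q14].
  have q1 : mem q 1 = mem s 1 by rewrite fq // fp // fh // fg // fd // fc // fb // fa.
  have fr : frame 6 s q.
    split=> [|k k6]; first by rewrite oq op oh og od oc ob oa.
    have lt m : 6 <= m -> k < m by apply: leq_trans.
    by rewrite fq ?fp ?fh ?fg ?fd ?fc ?fb ?fa ?lt //= !ltn_eqF ?lt.
  have := @runs_fan_tests w M n (i %/ n) (i %% n) (j %% n) (j %/ n) q.
  rewrite q1 q14 => /(_ rM xn yn zn) r.
  apply: runs_weaken (r _ _ _ _ _ _ _) (leqnn _) _ => //.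
  - by rewrite fq // fp // fh // fg // fd // fc // b8.
  - by rewrite fq // fp // fh // fg // fd // fc // b9.
  - by rewrite fq // fp // fh // fg // fd // fc // b10.
  - by rewrite fq // fp // fh // fg // d11.
  - by rewrite fq // fp // fh // fg // d12.
  - by rewrite fq // fp // h13.
  - by move=> s' [fr' ->]; split=> //; apply: frame_trans fr'.
by lia.
Qed.

Lemma below_nat_le P (x y z : 'I_(card P)) :
  below (nat_le P) x y z = below (@le P) x y z.
Proof. by rewrite /below !nat_leE. Qed.

Lemma fan_poset_computable :
  polytime_computable encode_pair encode_pair (fun PQ => (fan_poset PQ.1, fan_poset PQ.2)).
Proof.
apply: polytime_computable_pair runs_fan_card runs_fan_entry _ _ _ => // [n|P i j].
  by lia.
exact/(congr1 (andb _))/esym/(below_nat_le (divmod i).1 (divmod i).2 (divmod j).2).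
Qed.

Definition beacon_card : cmd := Add 3 2 2;; Add 3 3 0;; Add 3 3 0;; Add 3 3 0.

Lemma runs_beacon_card : computes_card beacon_card (fun n => n.+1 + n.+2) 100.
Proof.
move=> w s s0; apply: runs_run; [by [] | by rewrite /=; lia | split].
  by do !apply: frame_set.
by rewrite /= s0; lia.
Qed.

(* X_22 = n (i - 1); the read is only meaningful when the indices are in range. *)
Definition beacon_tests : cmd :=
  Sub 10 5 2;; Sub 11 4 2;; Neq 12 4 5;;
  Sub 7 5 0;; Add 7 7 22;; Add 7 7 1;; Read 7 7;; Sub 7 7 0.

(** [X_10] and [X_11] are positive when the column, respectively the row, lies in the antichain, and
    [X_12] when they differ; [X_7] is the matrix bit. *)
Definition beacon_decision : cmd :=
  If 10 (If 12 (Const 6 0) (Const 6 1))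
    (If 4 (If 11 (Const 6 0) (If 5 (Copy 6 7) (Const 6 0))) (Const 6 1)).

Definition beacon_entry : cmd :=
  (Copy 20 2;; Sub 21 4 0);; Mul;; beacon_tests;; beacon_decision.

(** This follows the numbering of [beacon_index]: columns beyond n belong to the antichain, row 0 to
    the least element. *)
Definition beacon_le n (M : rel nat) : rel nat := fun i j =>
  if n < j then i == j
  else (i == 0) || [&& i <= n, 0 < j & M i.-1 j.-1].

Lemma runs_beacon_entry :
  computes_entry beacon_entry (fun n => n.+1 + n.+2) beacon_le 100.
Proof.
move=> w M s n s0 s2 rM _ _; set i := mem s 4; set j := mem s 5.
apply: runs_leq.
  pose e := set_cell (set_cell (set_cell s 20 0) 20 n) 21 (i - 1).
  apply: runs_seq; first by apply: (@runs_run _ _ _ 3 (eq e)); rewrite //= s2 s0.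
  move=> _ <-; have := @runs_Mul w e s0; rewrite /= => r.
  apply: runs_seq r _ => a [[oa fa] a22].
  have {oa}fa : frame 20 s a.
    split=> // k k20; rewrite fa //= !ltn_eqF // (leq_trans k20) //.
  have [_ am] := fa.
  pose Q b := [/\ frame 7 a b, (0 < mem b 10) = (n < j), (0 < mem b 11) = (n < i),
    (0 < mem b 12) = (i != j)
    & mem b 7 = read w (mem s 1 + (n * (i - 1) + (j - 1))) - 1].
  apply: (@runs_seq _ _ _ _ 10 12 Q).
    apply: runs_run => //; split.
    - by do !apply: frame_set.
    - by rewrite /= !am // s2 subn_gt0.
    - by rewrite /= !am // s2 subn_gt0.
    - by rewrite /= !am // neq_nat_subn.
    - have [a0 a1 a5] : [/\ mem a 0 = 1, mem a 1 = mem s 1 & mem a 5 = j] by rewrite !am.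
      by rewrite /= a0 a1 a5 a22; congr (read _ _ - _); lia.
  move=> b [fb b10 b11 b12 b7].
  have fr : frame 7 s b by apply: frame_trans fb; apply: frame_leq fa.
  have b4 : mem b 4 = i by rewrite fr.2.
  have b5 : mem b 5 = j by rewrite fr.2.
  apply: runs_run => //; split.
    by rewrite /=; do !case: ifP => _; do !apply: frame_set => //; apply: frame_leq fr.
  rewrite /= b10 b11 b12 b4 b5 /beacon_le.
  case: (ltnP n j) => [_|jn] /=; first by case: (i == j).
  case: (posnP i) => [->|i0] //=; case: (ltnP n i) => //= iN.
  case: (posnP j) => [->|j0] //=; rewrite b7 add0n.
  have -> : n * (i - 1) + (j - 1) = i.-1 * n + j.-1 by rewrite mulnC !subn1.
  by rewrite rM; [case: (M _ _)|lia..].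
by rewrite /=; lia.
Qed.

Lemma beacon_poset_computable :
  polytime_computable encode_pair encode_pair
    (fun PQ => (beacon_poset PQ.1, beacon_poset PQ.2)).
Proof.
apply: polytime_computable_pair runs_beacon_card runs_beacon_entry _ _ _ => // [n|P i j].
  by lia.
set n := card P; rewrite -[LHS]/(beacon _ (beacon_index i) (beacon_index j)).
rewrite /beacon_index /beacon_le; case: splitP => a ea; case: splitP => b eb.
- rewrite ltnNge -ltnS eb ltn_ord /=.
  case: (unliftP ord0 a) ea => [a'|] -> -> //; rewrite lift0 ltn_ord /=.
  by case: (unliftP ord0 b) => [b'|] ->; rewrite // lift0 nat_leE.
- rewrite eb ltn_addr // ltn_eqF; last by rewrite ea ltn_addr.
  by case: (unlift _ _).
- rewrite ltnNge -ltnS eb ltn_ord /= ea //.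
  by rewrite leqNgt ltn_addr.
- rewrite eb ltn_addr // ea eqn_add2l.
  rewrite /= (inj_eq (inj_omap (@unlift_inj n.+1 ord0))).
  exact: (inj_eq (@unlift_inj n.+2 ord0)).
Qed.

Theorem theorem3p17 :
  polytime_reducible rotation_equivalence_up_to_isomorphism poset_isomorphism /\
  polytime_reducible poset_isomorphism rotation_equivalence_up_to_isomorphism.
Proof.
have rot (P Q : finposet) : rotation_isomorphic (@le P) (@le Q) <->
    cyc_isomorphic (@le P) (@le Q).
  exact: rotation_isomorphicP (@le_refl P) (@le_anti P)
    (@le_refl Q) (@le_anti Q) (@le_trans Q).
split.
- exists (fun PQ => (fan_poset PQ.1, fan_poset PQ.2)).
  split; first exact: fan_poset_computable.
  move=> [P Q] /=; apply: (iff_trans (rot P Q)).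
  apply: (iff_trans (fan_isomorphicP (@le_trans P) (@le_trans Q))).
  have [fP fQ] := (fan_poset_isomorphic P, fan_poset_isomorphic Q).
  split=> h.
    exact/(isomorphic_trans fP)/(isomorphic_trans h)/isomorphic_sym.
  exact/(isomorphic_trans (isomorphic_sym fP))/(isomorphic_trans h).
- exists (fun PQ => (beacon_poset PQ.1, beacon_poset PQ.2)).
  split; first exact: beacon_poset_computable.
  move=> [P Q] /=.
  apply: (iff_trans _ (iff_sym (rot (beacon_poset P) (beacon_poset Q)))).
  apply: (iff_trans (beacon_isomorphicP (@le_refl P) (@le_anti P)
    (@le_refl Q) (@le_anti Q))).
  (* Isomorphic posets have isomorphic cyclic sums, so the copies on ordinals may replace the
     beacons. *)
  have bP := beacon_poset_isomorphic P; have bQ := beacon_poset_isomorphic Q.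
  have [cP cP'] := (isomorphic_cyc bP, isomorphic_cyc (isomorphic_sym bP)).
  have [cQ cQ'] := (isomorphic_cyc bQ, isomorphic_cyc (isomorphic_sym bQ)).
  split=> h.
    exact: cyc_isomorphic_trans (cyc_isomorphic_trans cP h) cQ'.
  exact: cyc_isomorphic_trans (cyc_isomorphic_trans cP' h) cQ.
Qed.
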